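(* Let $k,m>0$ and consider the Sturm-Liouville problem in Liouville normal form $$\text{(N)}\qquad -\frac{d^2v}{dt^2}+\frac{k}{(t+m)^2}v=\lambda v,\quad 0<t<\pi,\qquad v(0)=0=v(\pi).$$ Let the potential function vanish, $q=0$, and let the density function be a constant $r=r_0>0$. Let $x_0\in\mathbb R$. (i) If $k\neq 3/4$, then for either choice of sign (the same choice throughout) (N) has the canonical form $$-\frac{d}{dx}\left\{\mathring r_0\,\big[(2\rho+1)(x+x_0)\big]^{4\rho/(2\rho+1)}\frac{du}{dx}\right\}=\lambda\,r_0\,u,\qquad a<x<b,$$ where $$\mathring r_0=r_0^{(2\rho-1)/(2\rho+1)},\qquad 2\rho+1=2\pm\sqrt{1+4k},$$ $$\frac{2\rho-1}{2\rho+1}=\frac{-(1+4k)\pm2\sqrt{1+4k}}{3-4k},\qquad \frac{4\rho}{2\rho+1}=\frac{2\left(1-4k\pm\sqrt{1+4k}\right)}{3-4k}.$$ (ii) If $k=3/4$, then (N) may take one of the following two distinct canonical forms: $$-\frac{d}{dx}\left\{8\sqrt{r_0}\,(x+x_0)^{3/2}\frac{du}{dx}\right\}=\lambda\,r_0\,u,\qquad a<x<b,$$ or $$-\frac{d}{dx}\left\{\frac1{r_0}e^{-2r_0(x+x_0)}\frac{du}{dx}\right\}=\lambda\,r_0\,u,\qquad a<x<b.$$ In each case $a<b$ are the points corresponding to $t=0$ and $t=\pi$, and the boundary conditions are the Dirichlet conditions $u(a)=0=u(b)$.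
   Context: A canonical form is a problem $-(p\,u')'+q\,u=\lambda r\,u$ on $a<x<b$, where $p,r>0$; $q$ is called the potential and $r$ the density function. We say that (N) has this canonical form if the two are related by Liouville's transformation: there is an increasing bijection $t\mapsto x(t)$ from $[0,\pi]$ onto $[a,b]$ with $dx/dt=\sqrt{p/r}$, and with $w=(pr)^{-1/4}$ one has $$\frac{k}{(t+m)^2}=\frac qr+w\frac{d^2}{dt^2}\left(\frac1w\right),$$ so that $u=wv$ turns (N), for every $\lambda$, into the canonical equation with the stated boundary conditions. *)

(* Defs.v *)
From Stdlib Require Import Reals.
From Coquelicot Require Import Coquelicot.

Open Scope R_scope.

(** The coefficients are total functions on [R]; only their values on
    [[lo, hi]] are meaningful. *)
Record sl_problem : Type := SLProblem {
  lo : R;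
  hi : R;
  sl_p : R -> R;
  sl_q : R -> R;
  sl_r : R -> R
}.

(** [-(p u')' + q u = lam r u] on the open interval.  [Derive] is total, so
    differentiability of [u] and of [p u'] is required separately. *)
Definition solves (P : sl_problem) (lam : R) (u : R -> R) : Prop :=
  forall x : R, lo P < x < hi P ->
    ex_derive u x /\
    ex_derive (fun y => sl_p P y * Derive u y) x /\
    - Derive (fun y => sl_p P y * Derive u y) x + sl_q P x * u x
      = lam * sl_r P x * u x.

(** Continuity up to the boundary ties the two boundary values to the values
    of [u] in the open interval, where the equation lives. *)
Definition dirichlet (P : sl_problem) (u : R -> R) : Prop :=
  continuous_on (fun x => lo P <= x <= hi P) u /\
  u (lo P) = 0 /\ u (hi P) = 0.

Definition normal_form (k m : R) : sl_problem :=
  SLProblem 0 PI (fun _ => 1) (fun t => k / (t + m) ^ 2) (fun _ => 1).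

Definition increasing_bijection (x : R -> R) (c d a b : R) : Prop :=
  (forall s t : R, c <= s -> s < t -> t <= d -> x s < x t) /\
  (forall t : R, c <= t <= d -> a <= x t <= b) /\
  (forall y : R, a <= y <= b -> exists t : R, c <= t <= d /\ x t = y).

(** [w = (p r)^(-1/4)] as a function of [t], along [x = x(t)]. *)
Definition liouville_w (P : sl_problem) (x : R -> R) (t : R) : R :=
  Rpower (sl_p P (x t) * sl_r P (x t)) (- (1 / 4)).

(** [t |-> x t] is a Liouville transformation from [N], which is in normal
    form (its [p] and [r] are 1), to [P].  [x] matters only on
    [[lo N, hi N]], so differential relations are imposed in the interior.
    In the last clause [u] and [v] are arbitrary (in particular [lam] need not
    be an eigenvalue): the equations and the boundary conditions correspond
    separately. *)
Definition liouville_transformation (N P : sl_problem) (x : R -> R) : Prop :=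
  let w := liouville_w P x in
  increasing_bijection x (lo N) (hi N) (lo P) (hi P) /\
  (forall t : R, lo N < t < hi N ->
     is_derive x t (sqrt (sl_p P (x t) / sl_r P (x t)))) /\
  (forall t : R, lo N < t < hi N ->
     ex_derive (fun s => / w s) t /\
     ex_derive_n (fun s => / w s) 2 t /\
     sl_q N t = sl_q P (x t) / sl_r P (x t)
                + w t * Derive_n (fun s => / w s) 2 t) /\
  (forall u v : R -> R,
     (forall t : R, lo N <= t <= hi N -> u (x t) = w t * v t) ->
     (forall lam : R, solves N lam v <-> solves P lam u) /\
     (dirichlet N v <-> dirichlet P u)).

(** The Dirichlet problem for [-v'' + k / (t + m)^2 v = lam v] on [(0, PI)] has
    the canonical form [-(p u')' + q u = lam r u] on some [(a, b)].  Positivity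
    of [p] and [r] includes the end points, where [u = w v] carries the boundary
    values. *)
Definition has_canonical_form (k m : R) (p q r : R -> R) : Prop :=
  exists (a b : R) (x : R -> R),
    a < b /\ x 0 = a /\ x PI = b /\
    (forall y : R, a <= y <= b -> 0 < p y /\ 0 < r y) /\
    liouville_transformation (normal_form k m) (SLProblem a b p q r) x.

(* Main.v *)
(** With [q = 0] and [r] constant, put [phi = 1/w = (p r)^(1/4)].  Liouville's
    relations become [phi'' = k / (t + m)^2 phi], [x' = phi^2 / r] and
    [p (x t) = phi^4 / r].  The Euler equation for [phi] has the solutions
    [(t + m)^s] with [s (s - 1) = k], that is [s = rho]; integrating [x'] gives
    [r (2 s + 1) (x + x0) = (t + m)^(2 s + 1)] if [2 s + 1 <> 0], and a
    logarithm, hence an exponential [p], if [s = -1/2]. *)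

Require Import Defs.
From Stdlib Require Import Reals Ranalysis5 Lra.
From Coquelicot Require Import Coquelicot.

Open Scope R_scope.

(* [phi] stands for [1/w] and [T] for the inverse of [x].  The domain extends
   beyond the interval of the problem, so that end points are interior points. *)
Record liouville_data (alpha r : R) (Q p phi dphi x T : R -> R) : Prop := {
  phi_pos : forall t, alpha < t -> 0 < phi t;
  phi_derive : forall t, alpha < t -> is_derive phi t (dphi t);
  dphi_derive : forall t, alpha < t -> is_derive dphi t (Q t * phi t);
  x_derive : forall t, alpha < t -> is_derive x t (phi t ^ 2 / r);
  p_along_x : forall t, alpha < t -> p (x t) = phi t ^ 4 / r;
  T_cancel : forall t, alpha < t -> T (x t) = t;
  T_derive : forall t, alpha < t -> is_derive T (x t) (r / phi t ^ 2)
}.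

Arguments phi_pos {alpha r Q p phi dphi x T}.
Arguments phi_derive {alpha r Q p phi dphi x T}.
Arguments dphi_derive {alpha r Q p phi dphi x T}.
Arguments x_derive {alpha r Q p phi dphi x T}.
Arguments p_along_x {alpha r Q p phi dphi x T}.
Arguments T_cancel {alpha r Q p phi dphi x T}.
Arguments T_derive {alpha r Q p phi dphi x T}.

(** * Local tools for derivatives and relative continuity *)

Lemma locally_Ioo (a b t : R) : a < t < b -> locally t (fun s => a < s < b).
Proof.
  intros [H1 H2].
  apply (locally_interval _ t a b); try easy.
Qed.

(** Needed because [u] and [v] determine each other only over the interval of the problem, so
    formulas for them can be differentiated only locally. *)
Lemma is_derive_ext_Ioo (a b : R) (f g : R -> R) (t l : R) :
  a < t < b -> (forall s, a < s < b -> f s = g s) ->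
  is_derive f t l -> is_derive g t l.
Proof.
  intros Ht Hfg. apply is_derive_ext_loc.
  exact (filter_imp _ _ Hfg (locally_Ioo a b t Ht)).
Qed.

(** Carries continuity up to the boundary between [v] and [u]: a smooth factor times a function
    composed with a change of variable. As [f] is continuous only relative to [E], [g] must map [D]
    into [E]. *)
Lemma continuous_on_mult_comp (D E : R -> Prop) (f g h F : R -> R) :
  continuous_on E f ->
  (forall y, D y -> continuous g y /\ E (g y) /\ continuous h y) ->
  (forall y, D y -> F y = h y * f (g y)) ->
  continuous_on D F.
Proof.
  intros Hf Hgh HF.
  apply continuous_on_ext with (f := fun y => h y * f (g y)).
  { intros y Hy; symmetry; exact (HF y Hy). }
  intros y Hy.
  destruct (Hgh y Hy) as [Hg [HE Hh]].
  apply (filterlim_comp_2 (F := within D (locally y)) (G := locally (h y))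
           (H := locally (f (g y))) h (fun z => f (g z)) Rmult).
  - apply filterlim_filter_le_1 with (2 := Hh).
    apply filter_le_within.
  - apply (filterlim_comp _ _ _ g f _ (within E (locally (g y)))).
    + intros P HP.
      specialize (Hg _ HP). unfold filtermap in Hg.
      unfold filtermap, within.
      refine (filter_imp _ _ _ Hg).
      intros z Hz HDz; apply Hz, (Hgh z HDz).
    + exact (Hf (g y) HE).
  - exact (filterlim_mult (K := R_AbsRing) (h y) (f (g y))).
Qed.

Lemma Rpower_pow_inv_root (y : R) (n : nat) :
  0 < y -> (0 < n)%nat -> Rpower (y ^ n) (- (1 / INR n)) = / y.
Proof.
  intros Hy Hn.
  rewrite <- Rpower_pow by assumption.
  rewrite Rpower_mult.
  replace (INR n * - (1 / INR n)) with (- (1)).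
  - now rewrite Rpower_Ropp, Rpower_1.
  - field. now apply not_0_INR, not_eq_sym, PeanoNat.Nat.lt_neq.
Qed.

(** * The Liouville transformation built from abstract data *)

Section LiouvilleData.

Context (alpha r : R) (Q p phi dphi x T : R -> R).
Context (Hr : 0 < r) (L : liouville_data alpha r Q p phi dphi x T).
Context (c d : R) (Hc : alpha < c) (Hcd : c < d).

Let N := SLProblem c d (fun _ => 1) Q (fun _ => 1).
Let P := SLProblem (x c) (x d) p (fun _ => 0) (fun _ => r).

Lemma x_increasing (s t : R) : alpha < s -> s < t -> x s < x t.
Proof.
  intros Hs Hst.
  apply (incr_function_le x s t (fun t => phi t ^ 2 / r)); try (simpl; lra).
  - intros z Hz _; simpl in Hz; apply (x_derive L); lra.
  - intros z Hz _; simpl in Hz; apply Rdiv_lt_0_compat; trivial.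
    apply pow_lt, (phi_pos L); lra.
Qed.

Lemma x_onto (y : R) : x c <= y <= x d -> exists t, c <= t <= d /\ x t = y.
Proof.
  intros Hy.
  destruct (f_interv_is_interv x c d y Hcd Hy) as [t Ht].
  - intros t Ht. apply continuity_pt_filterlim.
    apply (ex_derive_continuous x t). eexists.
    apply (x_derive L); lra.
  - now exists t.
Qed.

Lemma x_onto_interior (y : R) : x c < y < x d -> exists t, c < t < d /\ x t = y.
Proof.
  intros Hy.
  destruct (x_onto y) as [t [Ht E]]; [lra|].
  exists t; split; trivial.
  split.
  - destruct (Req_dec t c); [subst t|]; lra.
  - destruct (Req_dec t d); [subst t|]; lra.
Qed.

Lemma liouville_w_eq (t : R) : alpha < t -> liouville_w P x t = / phi t.
Proof.
  intros Ht. unfold liouville_w; simpl.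
  rewrite (p_along_x L) by exact Ht.
  replace (phi t ^ 4 / r * r) with (phi t ^ 4) by (field; lra).
  replace (1 / 4) with (1 / INR 4) by (simpl; f_equal; ring).
  apply Rpower_pow_inv_root.
  - now apply (phi_pos L).
  - apply PeanoNat.Nat.lt_0_succ.
Qed.

Lemma derive_comp_T (f : R -> R) (t l : R) :
  alpha < t -> is_derive f t l ->
  is_derive (fun y => f (T y)) (x t) (r / phi t ^ 2 * l).
Proof.
  intros Ht Hf.
  apply (is_derive_comp f T).
  - now rewrite (T_cancel L).
  - now apply (T_derive L).
Qed.

Lemma derive_comp_x (f : R -> R) (t l : R) :
  alpha < t -> is_derive f (x t) l ->
  is_derive (fun s => f (x s)) t (phi t ^ 2 / r * l).
Proof.
  intros Ht Hf.
  apply (is_derive_comp f x); trivial.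
  now apply (x_derive L).
Qed.

(** * Correspondence of solutions and of boundary conditions *)

Section Correspondence.

Context (u v : R -> R).
Context (Huv : forall t, c <= t <= d -> u (x t) = / phi t * v t).

Let pos t (Ht : alpha < t) : 0 < phi t := phi_pos L t Ht.

Lemma u_of_v (y : R) : x c <= y <= x d -> u y = / phi (T y) * v (T y).
Proof.
  intros Hy. destruct (x_onto y Hy) as [t [Ht E]].
  rewrite <- E, (T_cancel L) by lra.
  now apply Huv.
Qed.

Lemma v_of_u (t : R) : c <= t <= d -> v t = phi t * u (x t).
Proof.
  intros Ht. rewrite Huv by assumption.
  assert (0 < phi t) by (apply pos; lra).
  field; lra.
Qed.

(* As [p (x t) = phi t ^ 4 / r], the flux [p u'] is the Wronskian of [phi] and [v]. *)
Lemma u_derive_of_v (t : R) :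
  c < t < d -> ex_derive v t ->
  is_derive u (x t) (r / phi t ^ 4 * (phi t * Derive v t - dphi t * v t)).
Proof.
  intros Ht Hv.
  assert (Hp : 0 < phi t) by (apply pos; lra).
  apply (is_derive_ext_Ioo (x c) (x d) (fun y => / phi (T y) * v (T y))).
  { split; apply x_increasing; lra. }
  { intros y Hy; symmetry; apply u_of_v; lra. }
  evar_last.
  - apply (derive_comp_T (fun s => / phi s * v s)); [lra|].
    apply (is_derive_mult (fun s => / phi s) v).
    + apply is_derive_inv; [apply (phi_derive L); lra | lra].
    + now apply Derive_correct.
    + intros; apply Rmult_comm.
  - unfold plus, mult; simpl. field; lra.
Qed.

(** The flux [p u'] is kept whole because [solves] makes it, and not [u'] itself, differentiable; in
    this form [v'] can be differentiated once more. *)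
Lemma v_derive_of_u (t : R) :
  c < t < d -> ex_derive u (x t) ->
  is_derive v t (dphi t * u (x t) + p (x t) * Derive u (x t) / phi t).
Proof.
  intros Ht Hu.
  assert (Hp : 0 < phi t) by (apply pos; lra).
  apply (is_derive_ext_Ioo c d (fun s => phi s * u (x s))); trivial.
  { intros s Hs; symmetry; apply v_of_u; lra. }
  evar_last.
  - apply (is_derive_mult phi (fun s => u (x s))).
    + apply (phi_derive L); lra.
    + apply derive_comp_x; [lra|]. now apply Derive_correct.
    + intros; apply Rmult_comm.
  - rewrite (p_along_x L) by lra.
    unfold plus, mult; simpl. field; lra.
Qed.

(** The flux is the Wronskian [phi v' - phi' v], with [t]-derivative [phi v'' - phi'' v]. The terms
    in [Q] cancel and leave [- lam phi v]; the factor [r / phi^2] from [T] turns this into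
    [- lam r u]. *)
Lemma solves_push (lam : R) : solves N lam v -> solves P lam u.
Proof.
  intros Hs y Hy; simpl in Hy.
  destruct (x_onto_interior y Hy) as [t [Ht <-]].
  assert (Hp : 0 < phi t) by (apply pos; lra).
  destruct (Hs t Ht) as [Hv [Hv' Heq]]; simpl in Hv', Heq.
  assert (Hflux : is_derive (fun z : R => p z * Derive u z) (x t)
                    (- lam * r * u (x t))).
  (* The factor [1] is the leading coefficient of [N], kept so that [Hv'] applies literally. *)
  { apply (is_derive_ext_Ioo (x c) (x d)
      (fun z => phi (T z) * (1 * Derive v (T z)) - dphi (T z) * v (T z))); trivial.
    { intros z Hz. destruct (x_onto_interior z Hz) as [s [Hs' <-]].
      rewrite (is_derive_unique _ _ _ (u_derive_of_v s Hs' (proj1 (Hs s Hs')))).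
      rewrite (p_along_x L), (T_cancel L) by lra.
      assert (0 < phi s) by (apply pos; lra).
      field; lra. }
    evar_last.
    - apply (derive_comp_T (fun s => phi s * (1 * Derive v s) - dphi s * v s)); [lra|].
      apply (is_derive_minus (fun s => phi s * (1 * Derive v s)) (fun s => dphi s * v s)).
      + apply (is_derive_mult phi (fun s => 1 * Derive v s)).
        * apply (phi_derive L); lra.
        * apply Derive_correct, Hv'.
        * intros; apply Rmult_comm.
      + apply (is_derive_mult dphi v).
        * apply (dphi_derive L); lra.
        * apply Derive_correct, Hv.
        * intros; apply Rmult_comm.
    - unfold minus, plus, opp, mult; simpl.
      rewrite Huv by lra.
      replace (Derive (fun s => 1 * Derive v s) t) with (Q t * v t - lam * v t) by lra.
      field; lra. }
  split; [|split]; simpl.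
  - eexists; now apply u_derive_of_v.
  - eexists; exact Hflux.
  - rewrite (is_derive_unique _ _ _ Hflux). ring.
Qed.

(** On differentiating [v' = phi' u + (p u') / phi], the two terms in [phi' u'] cancel since
    [p = phi^4 / r] and [x' = phi^2 / r]. What remains is [Q phi u - lam phi u]. *)
Lemma solves_pull (lam : R) : solves P lam u -> solves N lam v.
Proof.
  intros Hs t Ht; simpl in Ht.
  assert (Hp : 0 < phi t) by (apply pos; lra).
  assert (Hx : forall s, c < s < d -> x c < x s < x d)
    by (intros; split; apply x_increasing; lra).
  destruct (Hs (x t) (Hx t Ht)) as [Hu [Hu' Heq]]; simpl in Hu', Heq.
  assert (Hv : is_derive (fun s : R => 1 * Derive v s) t ((Q t - lam) * v t)).
  { apply (is_derive_ext_Ioo c d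
      (fun s => dphi s * u (x s) + p (x s) * Derive u (x s) * / phi s)); trivial.
    { intros s Hs'.
      rewrite (is_derive_unique _ _ _ (v_derive_of_u s Hs' (proj1 (Hs _ (Hx s Hs'))))).
      unfold Rdiv; ring. }
    evar_last.
    - apply (is_derive_plus (fun s => dphi s * u (x s))
               (fun s => p (x s) * Derive u (x s) * / phi s)).
      + apply (is_derive_mult dphi (fun s => u (x s))).
        * apply (dphi_derive L); lra.
        * apply derive_comp_x; [lra|]. apply Derive_correct, Hu.
        * intros; apply Rmult_comm.
      + apply (is_derive_mult (fun s => p (x s) * Derive u (x s)) (fun s => / phi s)).
        * apply (derive_comp_x (fun y => p y * Derive u y)); [lra|].
          apply Derive_correct, Hu'.
        * apply is_derive_inv; [apply (phi_derive L); lra | lra].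
        * intros; apply Rmult_comm.
    - unfold plus, mult; simpl.
      rewrite v_of_u, (p_along_x L) by lra.
      replace (Derive (fun y => p y * Derive u y) (x t))
        with (- (lam * r * u (x t))) by lra.
      field; lra. }
  split; [|split]; simpl.
  - eexists; now apply v_derive_of_u.
  - eexists; exact Hv.
  - rewrite (is_derive_unique _ _ _ Hv). ring.
Qed.

(** Both [T] and [1 / phi] are continuous at the end points because the data extend beyond
    [[c, d]]. *)
Lemma dirichlet_push : dirichlet N v -> dirichlet P u.
Proof.
  intros [Hv [Hvc Hvd]]; simpl in Hv, Hvc, Hvd.
  split; [|split]; simpl.
  - apply (continuous_on_mult_comp _ (fun t => c <= t <= d) v T
             (fun y => / phi (T y))); trivial.
    + intros y Hy. destruct (x_onto y Hy) as [t [Ht <-]].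
      rewrite (T_cancel L) by lra.
      assert (0 < phi t) by (apply pos; lra).
      split; [|split]; trivial.
      * apply (ex_derive_continuous T). eexists.
        apply (T_derive L); lra.
      * apply (ex_derive_continuous (fun y => / phi (T y))). eexists.
        apply (derive_comp_T (fun s => / phi s)); [lra|].
        apply is_derive_inv; [apply (phi_derive L); lra | lra].
    + exact u_of_v.
  - rewrite Huv, Hvc by lra. ring.
  - rewrite Huv, Hvd by lra. ring.
Qed.

Lemma dirichlet_pull : dirichlet P u -> dirichlet N v.
Proof.
  intros [Hu [Huc Hud]]; simpl in Hu, Huc, Hud.
  split; [|split]; simpl.
  - apply (continuous_on_mult_comp _ (fun y => x c <= y <= x d) u x phi); trivial.
    + intros t Ht. split; [|split].
      * apply (ex_derive_continuous x). eexists.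
        apply (x_derive L); lra.
      * split; [destruct (Req_dec t c) | destruct (Req_dec t d)];
          try (subst t; lra); apply Rlt_le, x_increasing; lra.
      * apply (ex_derive_continuous phi). eexists.
        apply (phi_derive L); lra.
    + exact v_of_u.
  - rewrite v_of_u, Huc by lra. ring.
  - rewrite v_of_u, Hud by lra. ring.
Qed.

End Correspondence.

Lemma data_liouville_transformation : liouville_transformation N P x.
Proof.
  split; [|split; [|split]]; simpl.
  - split; [|split].
    + intros; apply x_increasing; lra.
    + intros t Ht.
      split; [destruct (Req_dec t c) | destruct (Req_dec t d)];
        try (subst t; lra); apply Rlt_le, x_increasing; lra.
    + exact x_onto.
  - intros t Ht.
    assert (Hp : 0 < phi t) by (apply (phi_pos L); lra).
    rewrite (p_along_x L) by lra.
    replace (phi t ^ 4 / r / r) with (Rsqr (phi t ^ 2 / r))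
      by (unfold Rsqr; field; lra).
    rewrite sqrt_Rsqr.
    + apply (x_derive L); lra.
    + apply Rlt_le, Rdiv_lt_0_compat; trivial. now apply pow_lt.
  - intros t Ht.
    assert (Hp : 0 < phi t) by (apply (phi_pos L); lra).
    (* The first derivative is needed on a neighbourhood of [t], as [H2] differentiates it again;
       [s + 1] below is just some right end point. *)
    assert (H1 : forall s, c < s -> is_derive (fun s => / liouville_w P x s) s (dphi s)).
    { intros s Hs. apply (is_derive_ext_Ioo c (s + 1) phi).
      - lra.
      - intros z Hz. rewrite liouville_w_eq by lra. symmetry; apply Rinv_inv.
      - apply (phi_derive L); lra. }
    assert (H2 : is_derive (Derive_n (fun s => / liouville_w P x s) 1) t (Q t * phi t)).
    { apply (is_derive_ext_Ioo c d dphi); trivial.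
      - intros s Hs; symmetry; apply is_derive_unique, H1; lra.
      - apply (dphi_derive L); lra. }
    split; [|split].
    + eexists; apply H1; lra.
    + eexists; exact H2.
    + replace (Derive _ t) with (Q t * phi t)
        by (symmetry; exact (is_derive_unique _ _ _ H2)).
      rewrite liouville_w_eq by lra.
      field; lra.
  - intros u v Huv.
    assert (Huv' : forall t, c <= t <= d -> u (x t) = / phi t * v t).
    { intros t Ht. rewrite Huv by assumption. rewrite liouville_w_eq by lra.
      reflexivity. }
    split; [intros lam|]; split.
    + now apply solves_push.
    + now apply solves_pull.
    + now apply dirichlet_push.
    + now apply dirichlet_pull.
Qed.

End LiouvilleData.

(** The choice [alpha = - m] uses the whole half-line on which the potential is regular; since
    [m > 0], it contains [[0, PI]] in its interior. *)
Lemma canonical_form_of_data (k m r : R) (p phi dphi x T : R -> R) :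
  0 < m -> 0 < r ->
  liouville_data (- m) r (fun t => k / (t + m) ^ 2) p phi dphi x T ->
  has_canonical_form k m p (fun _ => 0) (fun _ => r).
Proof.
  intros Hm Hr L.
  assert (Hpi := PI_RGT_0).
  assert (Hm0 : - m < 0) by lra.
  exists (x 0), (x PI), x.
  split; [|split; [|split; [|split]]]; trivial.
  - now apply (x_increasing (- m) r _ _ _ _ _ _ Hr L).
  - intros y Hy; split; trivial.
    destruct (x_onto (- m) r _ _ _ _ _ _ L 0 PI Hm0 Hpi y Hy) as [t [Ht <-]].
    rewrite (p_along_x L) by lra.
    apply Rdiv_lt_0_compat; trivial.
    apply pow_lt, (phi_pos L); lra.
  - now apply (data_liouville_transformation (- m) r _ _ _ _ _ _ Hr L).
Qed.

(** * Explicit data: powers of [t + m], and the logarithmic case *)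

Lemma is_derive_Rpower (a y : R) :
  0 < y -> is_derive (fun z => Rpower z a) y (a * Rpower y (a - 1)).
Proof.
  intros Hy.
  replace (Rpower y (a - 1)) with (Rpower y a / y).
  - unfold Rpower. auto_derive; [lra|]. field; lra.
  - unfold Rminus. rewrite Rpower_plus, Rpower_Ropp, Rpower_1 by assumption.
    reflexivity.
Qed.

Lemma is_derive_Rpower_shift (a m t : R) :
  0 < t + m ->
  is_derive (fun s => Rpower (s + m) a) t (a * Rpower (t + m) (a - 1)).
Proof.
  intros Ht.
  evar_last.
  - apply (is_derive_comp (fun z => Rpower z a) (fun s => s + m)).
    + now apply is_derive_Rpower.
    + auto_derive; [trivial | reflexivity].
  - unfold scal; simpl; unfold mult; simpl. ring.
Qed.

Lemma Rpower_pos (y a : R) : 0 < Rpower y a.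
Proof. apply exp_pos. Qed.

Lemma pow_Rpower (y a : R) (n : nat) : Rpower y a ^ n = Rpower y (a * INR n).
Proof. rewrite <- Rpower_pow by apply Rpower_pos. apply Rpower_mult. Qed.

(** The formula for [p] is required only at positive bases, where the range of [x] lies. This admits
    coefficients written differently, such as the one with constant 8, which differ from it at the
    default values of [Rpower]. *)
Lemma power_canonical_form (s k m r x0 : R) (p : R -> R) :
  0 < m -> 0 < r -> s * (s - 1) = k -> 2 * s + 1 <> 0 ->
  (forall y, 0 < (2 * s + 1) * (y + x0) ->
     p y = Rpower r ((2 * s - 1) / (2 * s + 1)) *
           Rpower ((2 * s + 1) * (y + x0)) (4 * s / (2 * s + 1))) ->
  has_canonical_form k m p (fun _ => 0) (fun _ => r).
Proof.
  intros Hm Hr Hk Hs Hp.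
  set (x := fun t => Rpower (t + m) (2 * s + 1) / (r * (2 * s + 1)) - x0).
  (* The right side is positive for either sign of [2 s + 1], so the two signs need no separate
     treatment: [x + x0] has the sign of [2 s + 1]. *)
  assert (Hx : forall t, (2 * s + 1) * (x t + x0) = Rpower (t + m) (2 * s + 1) / r).
  { intros t; unfold x; field; split; lra. }
  assert (Hx' : forall t, r * (2 * s + 1) * (x t + x0) = Rpower (t + m) (2 * s + 1)).
  { intros t; rewrite Rmult_assoc, Hx; field; lra. }
  apply (canonical_form_of_data k m r p (fun t => Rpower (t + m) s)
           (fun t => s * Rpower (t + m) (s - 1)) x
           (fun y => Rpower (r * (2 * s + 1) * (y + x0)) (1 / (2 * s + 1)) - m));
    trivial.
  split; intros t Ht.
  - apply Rpower_pos.
  - apply is_derive_Rpower_shift; lra.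
  - evar_last.
    + apply is_derive_scal, is_derive_Rpower_shift; lra.
    (* Euler equation: the fourth [s] is the exponent of [phi], and [(t + m)^s] is split as
       [(t + m)^(s - 2) (t + m)^2] to cancel the denominator of the potential. *)
    + replace s with (s - 1 - 1 + INR 2) at 4 by (simpl; ring).
      rewrite Rpower_plus, Rpower_pow by lra.
      rewrite <- Hk. field; lra.
  - unfold x. evar_last.
    + apply (is_derive_minus
               (fun t => Rpower (t + m) (2 * s + 1) / (r * (2 * s + 1))) (fun _ => x0)).
      * apply (is_derive_ext
                 (fun t => / (r * (2 * s + 1)) * Rpower (t + m) (2 * s + 1))).
        { intros z; unfold Rdiv; apply Rmult_comm. }
        apply is_derive_scal, is_derive_Rpower_shift; lra.
      * apply @is_derive_const.
    + rewrite pow_Rpower.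
      replace (s * INR 2) with (2 * s + 1 - 1) by (simpl; ring).
      unfold minus, plus, opp, zero; simpl.
      field; split; lra.
  - assert (H := Rpower_pos (t + m) (2 * s + 1)).
    assert (Hr' := Rinv_0_lt_compat r Hr).
    rewrite Hp, Hx.
    + unfold Rdiv at 2.
      rewrite <- Rpower_mult_distr by assumption.
      rewrite Rpower_mult, pow_Rpower.
      replace ((2 * s + 1) * (4 * s / (2 * s + 1))) with (s * INR 4)
        by (simpl; field; lra).
      replace (Rpower (/ r) (4 * s / (2 * s + 1)))
        with (/ Rpower r (4 * s / (2 * s + 1))).
      (* This identity dictates the exponent of [r] in [p]: the powers of [r] combine to [1 / r],
         leaving [phi^4 / r]. *)
      * replace (4 * s / (2 * s + 1)) with (1 + (2 * s - 1) / (2 * s + 1))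
          by (field; lra).
        rewrite Rpower_plus, Rpower_1 by assumption.
        assert (H' := Rpower_pos r ((2 * s - 1) / (2 * s + 1))).
        field; split; lra.
      * unfold Rpower. rewrite ln_Rinv, <- exp_Ropp by assumption. f_equal; ring.
    + rewrite Hx. now apply Rdiv_lt_0_compat.
  - rewrite Hx', Rpower_mult.
    replace ((2 * s + 1) * (1 / (2 * s + 1))) with 1 by (field; lra).
    rewrite Rpower_1; lra.
  - evar_last.
    + apply (is_derive_minus
               (fun y => Rpower (r * (2 * s + 1) * (y + x0)) (1 / (2 * s + 1)))
               (fun _ => m)).
      * apply (is_derive_comp (fun z => Rpower z (1 / (2 * s + 1)))
                 (fun y => r * (2 * s + 1) * (y + x0))).
        { apply is_derive_Rpower. rewrite Hx'. apply Rpower_pos. }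
        { auto_derive; [trivial | reflexivity]. }
      * apply @is_derive_const.
    + rewrite Hx', Rpower_mult, pow_Rpower.
      replace ((2 * s + 1) * (1 / (2 * s + 1) - 1)) with (- (s * INR 2))
        by (simpl; field; lra).
      rewrite Rpower_Ropp.
      assert (H := Rpower_pos (t + m) (s * INR 2)).
      revert H; generalize (Rpower (t + m) (s * INR 2)); intros z H.
      unfold minus, plus, opp, zero, scal; simpl; unfold mult; simpl.
      field; split; lra.
Qed.

(** This is the root [s = - 1/2] of [s (s - 1) = 3/4], where [2 s + 1 = 0]. Here
    [x' = 1 / (r (t + m))], so [r (x + x0) = ln (t + m)], and [phi^4 = (t + m)^(-2)] becomes the
    exponential. *)
Lemma exponential_canonical_form (m r x0 : R) :
  0 < m -> 0 < r ->
  has_canonical_form (3 / 4) m (fun x => 1 / r * exp (- 2 * r * (x + x0)))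
    (fun _ => 0) (fun _ => r).
Proof.
  intros Hm Hr.
  assert (Hpow : forall t, - m < t -> Rpower (t + m) (- (1 / 2)) ^ 2 = / (t + m)).
  { intros t Ht. rewrite pow_Rpower.
    replace (- (1 / 2) * INR 2) with (- (1)) by (simpl; field).
    now rewrite Rpower_Ropp, Rpower_1 by lra. }
  apply (canonical_form_of_data (3 / 4) m r _ (fun t => Rpower (t + m) (- (1 / 2)))
           (fun t => - (1 / 2) * Rpower (t + m) (- (1 / 2) - 1))
           (fun t => ln (t + m) / r - x0) (fun y => exp (r * (y + x0)) - m));
    trivial.
  assert (Hx : forall t, r * (ln (t + m) / r - x0 + x0) = ln (t + m)).
  { intros t; field; lra. }
  split; intros t Ht.
  - apply Rpower_pos.
  - apply is_derive_Rpower_shift; lra.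
  - evar_last.
    + apply is_derive_scal, is_derive_Rpower_shift; lra.
    + replace (- (1 / 2)) with (- (1 / 2) - 1 - 1 + INR 2) at 4 by (simpl; ring).
      rewrite Rpower_plus, Rpower_pow by lra.
      field; lra.
  - rewrite Hpow by assumption. auto_derive; [lra|]. field; lra.
  - replace (- 2 * r * (ln (t + m) / r - x0 + x0)) with (- ln (t + m) + - ln (t + m))
      by (field; lra).
    rewrite exp_plus, exp_Ropp, exp_ln by lra.
    replace (Rpower (t + m) (- (1 / 2)) ^ 4)
      with (Rpower (t + m) (- (1 / 2)) ^ 2 * Rpower (t + m) (- (1 / 2)) ^ 2) by ring.
    rewrite Hpow by assumption. field; lra.
  - rewrite Hx, exp_ln; lra.
  - rewrite Hpow by assumption. auto_derive; [trivial|].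
    rewrite Hx, exp_ln by lra. field; lra.
Qed.

(** * Distinctness of the two forms for [k = 3/4] *)

Lemma Rpower_nonpos (y a : R) : y <= 0 -> Rpower y a = 1.
Proof.
  intros Hy. unfold Rpower, ln.
  destruct (Rlt_dec 0 y); [exfalso; lra|].
  now rewrite Rmult_0_r, exp_0.
Qed.

(* [Rpower z a = 1] for [z <= 0], so the power need not be monotone
   on an interval containing [- x0]; one side of [- x0] is enough. *)
Lemma power_exponential_distinct (r x0 a b : R) :
  0 < r -> a < b ->
  exists x, a < x < b /\
    8 * sqrt r * Rpower (x + x0) (3 / 2) <> 1 / r * exp (- 2 * r * (x + x0)).
Proof.
  intros Hr Hab.
  (* Between two such points the power does not decrease while the exponential strictly does, so the
     coefficients cannot agree at both. *)
  assert (Hpts : exists x y, a < x /\ x < y /\ y < b /\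
            Rpower (x + x0) (3 / 2) <= Rpower (y + x0) (3 / 2)).
  { destruct (Rle_lt_dec 0 (a + x0)) as [Ha | Ha].
    - exists ((2 * a + b) / 3), ((a + 2 * b) / 3).
      repeat split; try lra.
      apply Rle_Rpower_l; lra.
    (* Left of [- x0] both powers take the default value 1. *)
    - set (c := Rmin b (- x0)).
      assert (a < c) by (apply Rmin_glb_lt; lra).
      assert (c <= b) by apply Rmin_l.
      assert (c <= - x0) by apply Rmin_r.
      exists ((2 * a + c) / 3), ((a + 2 * c) / 3).
      repeat split; try lra.
      rewrite !Rpower_nonpos; lra. }
  destruct Hpts as [x [y [Hx [Hxy [Hy Hle]]]]].
  assert (Hexp : 1 / r * exp (- 2 * r * (y + x0)) < 1 / r * exp (- 2 * r * (x + x0))).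
  { apply Rmult_lt_compat_l; [apply Rdiv_lt_0_compat; lra|].
    apply exp_increasing; nra. }
  assert (Hsqrt := sqrt_lt_R0 r Hr).
  assert (8 * sqrt r * Rpower (x + x0) (3 / 2) <= 8 * sqrt r * Rpower (y + x0) (3 / 2))
    by (apply Rmult_le_compat_l; lra).
  destruct (Req_dec (8 * sqrt r * Rpower (x + x0) (3 / 2))
              (1 / r * exp (- 2 * r * (x + x0)))).
  - exists y; split; lra.
  - exists x; split; lra.
Qed.

(** Source of the constant 8: for [rho = 3/2] the base is [4 (x + x0)] and the exponent [3/2]. *)
Lemma Rpower_4_3_2 : Rpower 4 (3 / 2) = 8.
Proof.
  replace 4 with (Rpower 2 2).
  - rewrite Rpower_mult. replace (2 * (3 / 2)) with (INR 3) by (simpl; field).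
    rewrite Rpower_pow by lra. ring.
  - replace 2 with (INR 2) at 2 by (simpl; ring). rewrite Rpower_pow by lra. ring.
Qed.

(** The interval is existential inside [has_canonical_form], so distinctness in (ii) is stated over
    every interval. *)
Theorem theorem2 (k m r0 x0 : R) (hk : 0 < k) (hm : 0 < m) (hr0 : 0 < r0) :
  (k <> 3 / 4 ->
   forall sgn rho : R,
     sgn = 1 \/ sgn = - 1 ->
     2 * rho + 1 = 2 + sgn * sqrt (1 + 4 * k) ->
     has_canonical_form k m
       (fun x => Rpower r0 ((2 * rho - 1) / (2 * rho + 1)) *
                 Rpower ((2 * rho + 1) * (x + x0)) (4 * rho / (2 * rho + 1)))
       (fun _ => 0)
       (fun _ => r0) /\
     (2 * rho - 1) / (2 * rho + 1)
       = (- (1 + 4 * k) + sgn * (2 * sqrt (1 + 4 * k))) / (3 - 4 * k) /\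
     4 * rho / (2 * rho + 1)
       = 2 * (1 - 4 * k + sgn * sqrt (1 + 4 * k)) / (3 - 4 * k)) /\
  (k = 3 / 4 ->
     has_canonical_form k m
       (fun x => 8 * sqrt r0 * Rpower (x + x0) (3 / 2))
       (fun _ => 0)
       (fun _ => r0) /\
     has_canonical_form k m
       (fun x => 1 / r0 * exp (- 2 * r0 * (x + x0)))
       (fun _ => 0)
       (fun _ => r0) /\
     (forall a b : R, a < b ->
        exists x : R, a < x < b /\
          8 * sqrt r0 * Rpower (x + x0) (3 / 2)
            <> 1 / r0 * exp (- 2 * r0 * (x + x0)))).
Proof.
  split.
  - intros Hk34 sgn rho Hsgn Hrho.
    assert (HS : (sgn * sqrt (1 + 4 * k)) ^ 2 = 1 + 4 * k).
    { rewrite Rpow_mult_distr, pow2_sqrt by lra. destruct Hsgn; subst sgn; ring. }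
    replace (sgn * (2 * sqrt (1 + 4 * k))) with (2 * (sgn * sqrt (1 + 4 * k))) by ring.
    (* From here only [S^2 = 1 + 4 k] matters, so both signs are handled at once and every identity
       is rational in [S]. *)
    set (S := sgn * sqrt (1 + 4 * k)) in *; clearbody S.
    (* Hence [3 - 4 k = (2 - S) (2 + S)], and [k <> 3/4] makes both factors nonzero; the second is
       [2 rho + 1]. *)
    assert (Hk : k = (S ^ 2 - 1) / 4) by lra.
    assert (HS2 : 2 + S <> 0).
    { intros HS2; apply Hk34. rewrite Hk. replace S with (- 2) by lra. field. }
    assert (HS2' : 2 - S <> 0).
    { intros HS2'; apply Hk34. rewrite Hk. replace S with 2 by lra. field. }
    assert (H34 : 3 - 4 * ((S ^ 2 - 1) / 4) <> 0) by (rewrite <- Hk; lra).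
    assert (Er : rho = (1 + S) / 2) by lra.
    split; [|split].
    + apply (power_canonical_form rho k m r0 x0); trivial.
      * rewrite Er, Hk. field.
      * lra.
    + rewrite Er, Hk. field. repeat split; lra.
    + rewrite Er, Hk. field. repeat split; lra.
  - intros ->; split; [|split].
    (* At [k = 3/4] the square root is 2: the plus sign gives [rho = 3/2], the minus sign the
       exceptional [rho = - 1/2]. *)
    + apply (power_canonical_form (3 / 2) (3 / 4) m r0 x0); trivial; try lra.
      intros y Hy.
      replace (2 * (3 / 2) + 1) with 4 in * by field.
      replace ((2 * (3 / 2) - 1) / 4) with (/ 2) by field.
      replace (4 * (3 / 2) / 4) with (3 / 2) by field.
      rewrite Rpower_sqrt by assumption.
      rewrite <- Rpower_mult_distr, Rpower_4_3_2 by lra. ring.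
    + now apply exponential_canonical_form.
    + intros a b Hab. now apply power_exponential_distinct.
Qed.
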